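(* Let $(\tilde W,G,H)$, with $\tilde W=\{\tilde W_j^n\}_{0\le j\le M,\,0\le n\le N}$, $G=\{G^n\}_{0\le n\le N}$ and $H=\{H^n\}_{0\le n\le N}$, be the solution of the finite difference scheme (S2) described in the context. If $\Delta t<1/L$, then $$\tilde W_j^n>0,\qquad 1\le j\le M-1,\quad 1\le n\le N,$$ and $$G^n<G^{n-1},\qquad H^n>H^{n-1},\qquad 1\le n\le N.$$
   Context: Data: $d,\mu_1,\mu_2,h_0,T,L$ are positive constants; $f:\mathbb{R}\to\mathbb{R}$ is differentiable and satisfies $-Lu\le f(u)\le Lu$ and $|f'(u)|\le L$ for all $u\ge 0$. The initial function satisfies $u_0\in C^2([-h_0,h_0])$, $u_0(-h_0)=u_0(h_0)=0$, and $u_0(x)>0$ for $-h_0<x<h_0$; put $\tilde w_0(\tilde z)=u_0((2\tilde z-1)h_0)$ for $0\le\tilde z\le1$, so that $\tilde w_0\in C^2([0,1])$, $\tilde w_0(0)=\tilde w_0(1)=0$ and $\tilde w_0>0$ on $(0,1)$. Mesh: $M\ge2$ and $N\ge1$ are integers, $\Delta\tilde z=1/M$, $\Delta t=T/N$, $\tilde z_j=j\Delta\tilde z$ for $0\le j\le M$. Difference operators: $\delta_t U_j^n=\frac{U_j^n-U_j^{n-1}}{\Delta t}$, $\delta_t Q^n=\frac{Q^n-Q^{n-1}}{\Delta t}$, $\delta_{\tilde z} U_{j+\frac12}^n=\frac{U_{j+1}^n-U_j^n}{\Delta\tilde z}$ for $0\le j\le M-1$, and $\delta_{\tilde z}^2U_j^n=\frac1{\Delta\tilde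 z}\bigl(\delta_{\tilde z}U_{j+\frac12}^n-\delta_{\tilde z}U_{j-\frac12}^n\bigr)$ for $1\le j\le M-1$. Scheme (S2) (a discretization of the double free boundary problem $u_t=du_{xx}+f(u)$ on $g(t)<x<h(t)$, $u(t,g(t))=u(t,h(t))=0$, $g'(t)=-\mu_1u_x(t,g(t))$, $h'(t)=-\mu_2u_x(t,h(t))$, $g(0)=-h_0$, $h(0)=h_0$, $u(0,x)=u_0(x)$, after the change of variables $\tilde z=\frac{x-g(t)}{h(t)-g(t)}$, $\tilde w(t,\tilde z)=u(t,x)$; $\tilde W_j^n,G^n,H^n$ approximate $\tilde w(t_n,\tilde z_j),g(t_n),h(t_n)$ with $t_n=n\Delta t$): the initial values are $G^0=-h_0$, $H^0=h_0$, $\tilde W_j^0=\tilde w_0(\tilde z_j)$, $0\le j\le M$, and for $1\le n\le N$ $$\delta_t\tilde W_j^n-\frac{(1-\tilde z_j)\,\delta_tG^n}{H^n-G^n}\,\delta_{\tilde z}\tilde W_{j-\frac12}^n-\frac{\tilde z_j\,\delta_tH^n}{H^n-G^n}\,\delta_{\tilde z}\tilde W_{j+\frac12}^n-\frac{d}{(H^n-G^n)^2}\,\delta_{\tilde z}^2\tilde W_j^n=f(\tilde W_j^{n-1}),\quad 1\le j\le M-1,$$ $$\tilde W_0^n=0,\qquad \tilde W_M^n=0,$$ $$\delta_tG^n=-\frac{\mu_1}{H^{n-1}-G^{n-1}}\,\delta_{\tilde z}\tilde W_{\frac12}^{n-1},\qquad \delta_tH^n=-\frac{\mu_2}{H^{n-1}-G^{n-1}}\,\delta_{\tilde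 z}\tilde W_{M-\frac12}^{n-1}.$$ *)

(* Defs.v *)
From HB Require Import structures.
From mathcomp Require Export all_boot all_order all_algebra.
From mathcomp Require Export all_classical all_reals all_analysis.
Export Order.TTheory GRing.Theory Num.Theory.
Export numFieldNormedType.Exports.
Set Implicit Arguments.
Unset Strict Implicit.
Unset Printing Implicit Defensive.
Local Open Scope classical_set_scope.
Local Open Scope ring_scope.

(* The difference quotients are restricted to A: on a closed interval this is
   the two-sided derivative inside and the one-sided one at the endpoints. *)
Definition has_derive_on (R : realType) (A : set R) (f f' : R -> R) : Prop :=
  forall x, A x ->
    (f y - f x) / (y - x) @[y --> within A x^'] --> f' x.

Definition C2_on (R : realType) (A : set R) (f : R -> R) : Prop :=
  exists f' f'' : R -> R,
    [/\ has_derive_on A f f', has_derive_on A f' f''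
      & {within A, continuous f''}].

Definition w0 (R : realType) (h0 : R) (u0 : R -> R) (z : R) : R :=
  u0 ((2 * z - 1) * h0).

Definition mesh_dt (R : realType) (T : R) (N : nat) : R := T / N%:R.
Definition mesh_dz (R : realType) (M : nat) : R := 1 / M%:R.
Definition mesh_z (R : realType) (M j : nat) : R := j%:R * mesh_dz R M.

Definition delta_t (R : realType) (dt : R) (Q : nat -> R) (n : nat) : R :=
  (Q n - Q n.-1) / dt.

(* Half-integer nodes are indexed by their left neighbour: [delta_z dz U j] is
   the difference quotient at j + 1/2, so that j - 1/2 corresponds to j.-1
   (for j >= 1). *)
Definition delta_z (R : realType) (dz : R) (U : nat -> R) (j : nat) : R :=
  (U j.+1 - U j) / dz.

Definition delta_z2 (R : realType) (dz : R) (U : nat -> R) (j : nat) : R :=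
  1 / dz * (delta_z dz U j - delta_z dz U j.-1).

(* [W n j] is the value at time level n and node j; only the indices n <= N and
   j <= M are constrained. *)
Record is_solution_S2 (R : realType) (d mu1 mu2 h0 T : R) (f u0 : R -> R)
    (M N : nat) (W : nat -> nat -> R) (G H : nat -> R) : Prop := {
  S2_G0 : G 0%N = - h0;
  S2_H0 : H 0%N = h0;
  S2_W0 : forall j, (j <= M)%N -> W 0%N j = w0 h0 u0 (mesh_z R M j);
  S2_W : forall n j, (1 <= n <= N)%N -> (1 <= j <= M.-1)%N ->
    let dt := mesh_dt T N in
    let dz := mesh_dz R M in
    let z := mesh_z R M j in
    delta_t dt (fun m => W m j) n
    - (1 - z) * delta_t dt G n / (H n - G n) * delta_z dz (W n) j.-1
    - z * delta_t dt H n / (H n - G n) * delta_z dz (W n) j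
    - d / (H n - G n) ^+ 2 * delta_z2 dz (W n) j
    = f (W n.-1 j);
  S2_left : forall n, (1 <= n <= N)%N -> W n 0%N = 0;
  S2_right : forall n, (1 <= n <= N)%N -> W n M = 0;
  S2_G : forall n, (1 <= n <= N)%N ->
    delta_t (mesh_dt T N) G n
    = - (mu1 / (H n.-1 - G n.-1)) * delta_z (mesh_dz R M) (W n.-1) 0%N;
  S2_H : forall n, (1 <= n <= N)%N ->
    delta_t (mesh_dt T N) H n
    = - (mu2 / (H n.-1 - G n.-1)) * delta_z (mesh_dz R M) (W n.-1) M.-1
}.

(* Main.v *)
Require Import Defs.
From mathcomp Require Import ring lra zify.
Set Implicit Arguments.
Unset Strict Implicit.
Unset Printing Implicit Defensive.
Local Open Scope classical_set_scope.
Local Open Scope ring_scope.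

(** Positivity of the density and monotonicity of the two fronts are proved
    together, by induction on the time level.

    Suppose that level [n] is positive at the interior nodes, vanishes at both
    ends, and has a positive domain length [H n - G n].  Its discrete slope is
    then positive at the left end and negative at the right end, so the explicit
    front equations push [G] down and [H] up; in particular the domain length
    stays positive.  These signs make the implicit scheme monotone: its
    advection terms are upwinded, and each interior equation takes the form
    [U j + a (U j - U j.-1) + b (U j - U j.+1) = W n j + dt * f (W n j)] for
    [U = W n.+1], with [a, b >= 0] ([implicit_step_monotone_form]).  The
    right-hand side is at least [(1 - L * dt) * W n j], which is positive
    exactly because [dt < 1 / L].  A discrete minimum principle
    ([discrete_minimum_principle]) then gives positivity at level [n.+1]. *)

(** At an interior node where [U] is smallest, a nonpositive value would not exceed
    either neighbour (the boundary values being nonnegative), and the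
    operator would be nonpositive there. *)
Lemma discrete_minimum_principle (R : realDomainType) (M : nat)
    (U a b : nat -> R) :
  0 <= U 0%N -> 0 <= U M ->
  (forall j, (0 < j < M)%N -> 0 <= a j) ->
  (forall j, (0 < j < M)%N -> 0 <= b j) ->
  (forall j, (0 < j < M)%N ->
    0 < U j + a j * (U j - U j.-1) + b j * (U j - U j.+1)) ->
  forall j, (0 < j < M)%N -> 0 < U j.
Proof.
move=> U0 UM a_ge0 b_ge0 opU_gt0 j j_in; rewrite ltNge; apply/negP => Uj_le0.
have j_lt : (j < M.+1)%N by lia.
case: (@arg_minP _ _ _ (Ordinal j_lt) (fun i : 'I_M.+1 => 0 < i < M)%N
        (fun i => U i) j_in) => i i_in Ui_min.
have Ui_le0 : U i <= 0 := le_trans (Ui_min (Ordinal j_lt) j_in) Uj_le0.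
have Ui_le k : (k <= M)%N -> U i <= U k.
  move=> k_le; have [->|k0] := eqVneq k 0%N; first exact: le_trans U0.
  have [->|kM] := eqVneq k M; first exact: le_trans UM.
  have k_lt : (k < M.+1)%N by [].
  by apply: (Ui_min (Ordinal k_lt)) => /=; lia.
have := opU_gt0 i i_in; rewrite ltNge => /negP; apply.
have leftU : a i * (U i - U i.-1) <= 0.
  by rewrite mulr_ge0_le0 ?a_ge0// subr_le0 Ui_le//; lia.
have rightU : b i * (U i - U i.+1) <= 0.
  by rewrite mulr_ge0_le0 ?b_ge0// subr_le0 Ui_le//; lia.
by rewrite -[leRHS](addr0 0) lerD// -[leRHS](addr0 0) lerD.
Qed.

Lemma explicit_reaction_gt0 (R : realFieldType) (L dt w y : R) :
  0 < L -> 0 < dt -> dt < 1 / L -> 0 < w -> - L * w <= y -> 0 < w + dt * y.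
Proof.
move=> L_gt0 dt_gt0 dt_lt w_gt0 y_ge.
have Ldt_lt1 : dt * L < 1 by rewrite -ltr_pdivlMr.
have damped_gt0 : 0 < (1 - dt * L) * w by rewrite mulr_gt0// subr_gt0.
have := ler_wpM2l (ltW dt_gt0) y_ge; lra.
Qed.

(** Collects, in one equation of the implicit step multiplied by [dt], the
    weights of the two differences of the unknown: the velocities [vG] and [vH]
    of the fronts act through the one-sided differences on the sides that keep
    the weights nonnegative when [vG <= 0 <= vH]. *)
Lemma implicit_step_monotone_form (R : realType)
    (dt dz d z l vG vH w y : R) (U : nat -> R) (j : nat) :
  dt != 0 -> dz != 0 -> l != 0 -> (0 < j)%N ->
  (U j - w) / dt - (1 - z) * vG / l * delta_z dz U j.-1
    - z * vH / l * delta_z dz U j - d / l ^+ 2 * delta_z2 dz U j = y ->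
  U j + dt * ((1 - z) * - vG / (l * dz) + d / (l * dz) ^+ 2) * (U j - U j.-1)
      + dt * (z * vH / (l * dz) + d / (l * dz) ^+ 2) * (U j - U j.+1)
    = w + dt * y.
Proof.
move=> dt_neq0 dz_neq0 l_neq0 j_gt0 <-.
by rewrite /delta_z2 /delta_z (prednK j_gt0); field; apply/and3P.
Qed.

Lemma mesh_z_gt0_lt1 (R : realType) (M j : nat) :
  (0 < j < M)%N -> 0 < mesh_z R M j < 1.
Proof.
move=> /andP[j_gt0 j_lt].
have M_gt0 : 0 < M%:R :> R by rewrite ltr0n; lia.
rewrite /mesh_z /mesh_dz mul1r divr_gt0 ?ltr0n//=; last by lia.
by rewrite ltr_pdivrMr// mul1r ltr_nat.
Qed.

Lemma centered_coordinate_bounds (R : realDomainType) (h z : R) :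
  0 < h -> 0 < z < 1 -> - h < (2 * z - 1) * h < h.
Proof.
move=> h_gt0 /andP[z_gt0 z_lt1].
have left_gt0 := mulr_gt0 z_gt0 h_gt0.
have right_gt0 : 0 < (1 - z) * h by rewrite mulr_gt0// subr_gt0.
by apply/andP; split; lra.
Qed.

Lemma pred_interior (M : nat) : (2 <= M)%N -> (0 < M.-1 < M)%N.
Proof. by lia. Qed.

Section TimeStepping.
Variables (R : realType) (d mu1 mu2 h0 T L : R) (f u0 : R -> R).
Variables (M N : nat) (W : nat -> nat -> R) (G H : nat -> R).
Hypotheses (d_gt0 : 0 < d) (mu1_gt0 : 0 < mu1) (mu2_gt0 : 0 < mu2).
Hypotheses (h0_gt0 : 0 < h0) (T_gt0 : 0 < T) (L_gt0 : 0 < L).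
Hypothesis f_ge : forall u : R, 0 <= u -> - L * u <= f u.
Hypotheses (u0_left : u0 (- h0) = 0) (u0_right : u0 h0 = 0).
Hypothesis u0_gt0 : forall x : R, - h0 < x < h0 -> 0 < u0 x.
Hypotheses (M_ge2 : (2 <= M)%N) (N_ge1 : (1 <= N)%N).
Hypothesis solWGH : is_solution_S2 d mu1 mu2 h0 T f u0 M N W G H.
Hypothesis dt_small : mesh_dt T N < 1 / L.

Let dt_gt0 : 0 < mesh_dt T N.
Proof. by rewrite /mesh_dt divr_gt0// ltr0n. Qed.

Let dz_gt0 : 0 < mesh_dz R M.
Proof. by rewrite /mesh_dz divr_gt0// ltr0n ltnW. Qed.

(** The induction invariant.  The boundary values are part of it because at
    level 0 they come from [u0] and not from the scheme. *)
Record positive_level (n : nat) : Prop := PositiveLevel {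
  level_gt0 : forall j, (0 < j < M)%N -> 0 < W n j;
  level_left : W n 0%N = 0;
  level_right : W n M = 0;
  level_length : 0 < H n - G n
}.

Lemma positive_level0 : positive_level 0.
Proof.
have M_neq0 : M%:R != 0 :> R by rewrite pnatr_eq0 -lt0n ltnW.
split.
- move=> j j_in; rewrite (S2_W0 solWGH); last by case/andP: j_in => _ /ltnW.
  exact/u0_gt0/centered_coordinate_bounds/mesh_z_gt0_lt1.
- rewrite (S2_W0 solWGH)// /w0 /mesh_z mul0r mulr0.
  by rewrite sub0r mulN1r.
- rewrite (S2_W0 solWGH)// /w0 /mesh_z /mesh_dz mul1r divff//.
  by rewrite mulr1 (natrD _ 1 1) addrK mul1r.
- by rewrite (S2_G0 solWGH) (S2_H0 solWGH) opprK addr_gt0.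
Qed.

(** The outward slopes at the ends are those of a function positive inside and
    zero at the boundary. *)
Lemma front_velocities n : (n < N)%N -> positive_level n ->
  delta_t (mesh_dt T N) G n.+1 < 0 /\ 0 < delta_t (mesh_dt T N) H n.+1.
Proof.
move=> n_lt [W_gt0 W_left W_right len_gt0].
rewrite (S2_G solWGH)// (S2_H solWGH)//= /delta_z W_left subr0.
rewrite (prednK (ltnW M_ge2)) W_right sub0r; split.
  by rewrite mulNr oppr_lt0 mulr_gt0// divr_gt0// W_gt0//= M_ge2.
by rewrite !mulNr mulrN opprK mulr_gt0// divr_gt0// W_gt0// pred_interior.
Qed.

Lemma front_step n : (n < N)%N -> positive_level n ->
  G n.+1 < G n /\ H n < H n.+1.
Proof.
move=> n_lt /(front_velocities n_lt)[].
by rewrite /delta_t ltr_pdivrMr// ltr_pdivlMr// !mul0r subr_lt0 subr_gt0.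
Qed.

Lemma positive_levelS n : (n < N)%N -> positive_level n ->
  positive_level n.+1.
Proof.
move=> n_lt Pn; have [W_gt0 _ _ len_gt0] := Pn.
have [vG_lt0 vH_gt0] := front_velocities n_lt Pn.
have lenS_gt0 : 0 < H n.+1 - G n.+1.
  have [G_lt H_lt] := front_step n_lt Pn.
  by apply: (lt_trans len_gt0); rewrite ltrD// ltrN2.
have WS_left : W n.+1 0 = 0 by apply: (S2_left solWGH).
have WS_right : W n.+1 M = 0 by apply: (S2_right solWGH).
have ldz_ge0 : 0 <= (H n.+1 - G n.+1) * mesh_dz R M by rewrite mulr_ge0 ?ltW.
have diffusion_ge0 : 0 <= d / ((H n.+1 - G n.+1) * mesh_dz R M) ^+ 2.
  by rewrite divr_ge0 ?(ltW d_gt0)// exprn_ge0.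
split=> //.
pose a j := mesh_dt T N *
  ((1 - mesh_z R M j) * - delta_t (mesh_dt T N) G n.+1
     / ((H n.+1 - G n.+1) * mesh_dz R M)
   + d / ((H n.+1 - G n.+1) * mesh_dz R M) ^+ 2).
pose b j := mesh_dt T N *
  (mesh_z R M j * delta_t (mesh_dt T N) H n.+1
     / ((H n.+1 - G n.+1) * mesh_dz R M)
   + d / ((H n.+1 - G n.+1) * mesh_dz R M) ^+ 2).
apply: (@discrete_minimum_principle _ M (W n.+1) a b).
- by rewrite WS_left.
- by rewrite WS_right.
- move=> j /(mesh_z_gt0_lt1 R) /andP[_ z_lt1].
  rewrite mulr_ge0 ?(ltW dt_gt0)// addr_ge0// divr_ge0//.
  by rewrite mulr_ge0 ?subr_ge0 ?oppr_ge0 ?ltW.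
- move=> j /(mesh_z_gt0_lt1 R) /andP[z_gt0 _].
  rewrite mulr_ge0 ?(ltW dt_gt0)// addr_ge0// divr_ge0//.
  by rewrite mulr_ge0 ?ltW.
move=> j j_in.
have /andP[j_gt0 j_lt] := j_in.
have j_range : (1 <= j <= M.-1)%N.
  by rewrite j_gt0 -ltnS (prednK (ltnW M_ge2)).
have dt_neq0 : mesh_dt T N != 0 by rewrite gt_eqF.
have dz_neq0 : mesh_dz R M != 0 by rewrite gt_eqF.
have len_neq0 : H n.+1 - G n.+1 != 0 by rewrite gt_eqF.
have n_range : (1 <= n.+1 <= N)%N by [].
have stepE := implicit_step_monotone_form dt_neq0 dz_neq0 len_neq0 j_gt0
  (S2_W solWGH n_range j_range).
rewrite /a /b stepE /=; apply: (explicit_reaction_gt0 L_gt0) => //.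
  exact: W_gt0.
exact/f_ge/ltW/W_gt0.
Qed.

Lemma positive_levels n : (n <= N)%N -> positive_level n.
Proof.
elim: n => [_|n IHn n_lt]; first exact: positive_level0.
exact: positive_levelS n_lt (IHn (ltnW n_lt)).
Qed.

End TimeStepping.

Theorem theorem3p2 (R : realType) (d mu1 mu2 h0 T L : R) (f u0 : R -> R)
    (M N : nat) (W : nat -> nat -> R) (G H : nat -> R)
    (d_gt0 : 0 < d) (mu1_gt0 : 0 < mu1) (mu2_gt0 : 0 < mu2)
    (h0_gt0 : 0 < h0) (T_gt0 : 0 < T) (L_gt0 : 0 < L)
    (f_derivable : forall u : R, derivable f u 1)
    (f_bound : forall u : R, 0 <= u -> - L * u <= f u <= L * u)
    (f'_bound : forall u : R, 0 <= u -> `|derive1 f u| <= L)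
    (u0_C2 : C2_on `[- h0, h0] u0)
    (u0_left : u0 (- h0) = 0) (u0_right : u0 h0 = 0)
    (u0_gt0 : forall x : R, - h0 < x < h0 -> 0 < u0 x)
    (M_ge2 : (2 <= M)%N) (N_ge1 : (1 <= N)%N)
    (solWGH : is_solution_S2 d mu1 mu2 h0 T f u0 M N W G H)
    (dt_small : mesh_dt T N < 1 / L) :
  (forall n j, (1 <= n <= N)%N -> (1 <= j <= M.-1)%N -> 0 < W n j) /\
  (forall n, (1 <= n <= N)%N -> G n < G n.-1 /\ H n.-1 < H n).
Proof.
have f_ge u : 0 <= u -> - L * u <= f u by move=> /f_bound /andP[].
have level n : (n <= N)%N -> positive_level M W G H n.
  exact: (positive_levels d_gt0 mu1_gt0 mu2_gt0 h0_gt0 T_gt0 L_gt0 f_ge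
            u0_left u0_right u0_gt0 M_ge2 N_ge1 solWGH dt_small).
split.
  by move=> n j /andP[_ /level Pn] j_in; apply: (level_gt0 Pn); lia.
case=> [|n] //= n_lt.
exact: (front_step mu1_gt0 mu2_gt0 T_gt0 M_ge2 N_ge1 solWGH n_lt
          (level n (ltnW n_lt))).
Qed.
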